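(* There is an embedding $\mathcal{B} \hookrightarrow \mathcal{G}$ which, for every $X \subseteq \omega$, restricts to an embedding $\mathcal{B}^X \hookrightarrow \mathcal{G}^{X \oplus \overline{X}}$ (where $\overline{X} = \omega \setminus X$ and $X\oplus \overline X = \{2n : n\in X\}\cup\{2n+1 : n \notin X\}$).
   Context: A partial combinatory algebra (pca) is a set $A$ with a partial binary operation $\cdot$ (application, associating to the left) containing distinct elements $\mathrm{s},\mathrm{k}$ such that for all $a,b,c$: $\mathrm{k}ab$ is defined and equals $a$; $\mathrm{s}ab$ is defined; and $\mathrm{s}abc \simeq (ac)(bc)$ (Kleene equality). An embedding of pcas $\mathcal{A}\hookrightarrow\mathcal{A}'$ is an injective map $f$ such that whenever $a\cdot b$ is defined in $\mathcal{A}$, $f(a)\cdot f(b)$ is defined in $\mathcal{A}'$ and equals $f(a\cdot b)$. Van Oosten's model $\mathcal{B}$ (in the coding used here): the elements are the partial functions $\omega \rightharpoonup \omega$, and for $\varphi,\psi$ the application $\varphi\cdot\psi$ is the partial function $n \mapsto \Phi^{\varphi\oplus\psi}_{\varphi(0)}(n)$, where $\Phi_e$ is the $e$-th Turing functional, $(\varphi\oplus\psi)(2n)\simeq\varphi(n)$, $(\varphi\oplus\psi)(2n+1)\simeq\psi(n)$, and a query to the oracle at a point where it is undefined makes the computation diverge; application is always defined. $\mathcal{B}^X$ is the sub-pca of partial $X$-computable functions. Scott's graph model $\mathcal{G}$: the carrier is $\mathcal{P}(\omega)$, with application $A\cdot B = \{n : \exists u\, (\langle n,u\rangle \in A \wedge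 D_u\subseteq B)\}$, where $\langle\cdot,\cdot\rangle$ is a bijective computable pairing with $\langle 0,0\rangle=0$ and $D_u$ is the finite set with canonical code $u$ (the set $F$ is coded by $\sum_{k\in F}2^k$). For $Y\subseteq\omega$, $\mathcal{G}^Y$ is the least class of sets containing $Y$ and all c.e. sets and closed under application; equivalently the sets enumeration-reducible to $Y$. These are pcas. *)

(* Defs.v *)
From HB Require Import structures.
From mathcomp Require Import all_boot.

Set Implicit Arguments.
Unset Strict Implicit.
Unset Printing Implicit Defensive.

(* Cantor pairing  <x,y> = (x+y)(x+y+1)/2 + y ;  a computable bijection     *)
(* nat*nat -> nat with <0,0> = 0.                                            *)
Definition cpair (x y : nat) : nat := ((x + y) * (x + y).+1)./2 + y.

(* Canonical finite sets: D_u = { k | bit k of u is 1 }  (F coded by sum 2^k) *)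
Definition D (u : nat) : nat -> Prop := fun k => Nat.testbit u k = true.

(* Oracle programs: unary partial recursive functions relative to an oracle. *)
(* Basis (complete for partial recursive functions of one argument, using    *)
(* Cantor pairing for tuples):                                               *)
Inductive code : Type :=
  | CZero
  | CSucc
  | CId
  | CFst
  | CSnd
  | CPair of code & code
  | CComp of code & code
  | CPrim of code & code
  | CMu of code
  | COracle.

Fixpoint code_to_tree (c : code) : GenTree.tree nat :=
  match c with
  | CZero => GenTree.Node 0 [::]
  | CSucc => GenTree.Node 1 [::]
  | CId => GenTree.Node 2 [::]
  | CFst => GenTree.Node 3 [::]
  | CSnd => GenTree.Node 4 [::]
  | CPair f g => GenTree.Node 5 [:: code_to_tree f; code_to_tree g]
  | CComp f g => GenTree.Node 6 [:: code_to_tree f; code_to_tree g]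
  | CPrim f g => GenTree.Node 7 [:: code_to_tree f; code_to_tree g]
  | CMu f => GenTree.Node 8 [:: code_to_tree f]
  | COracle => GenTree.Node 9 [::]
  end.

Fixpoint tree_to_code (t : GenTree.tree nat) : option code :=
  match t with
  | GenTree.Node 0 [::] => Some CZero
  | GenTree.Node 1 [::] => Some CSucc
  | GenTree.Node 2 [::] => Some CId
  | GenTree.Node 3 [::] => Some CFst
  | GenTree.Node 4 [::] => Some CSnd
  | GenTree.Node 5 [:: t1; t2] =>
      match tree_to_code t1, tree_to_code t2 with
      | Some f, Some g => Some (CPair f g) | _, _ => None end
  | GenTree.Node 6 [:: t1; t2] =>
      match tree_to_code t1, tree_to_code t2 with
      | Some f, Some g => Some (CComp f g) | _, _ => None end
  | GenTree.Node 7 [:: t1; t2] =>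
      match tree_to_code t1, tree_to_code t2 with
      | Some f, Some g => Some (CPrim f g) | _, _ => None end
  | GenTree.Node 8 [:: t1] =>
      match tree_to_code t1 with Some f => Some (CMu f) | None => None end
  | GenTree.Node 9 [::] => Some COracle
  | _ => None
  end.

Lemma code_treeK : pcancel code_to_tree tree_to_code.
Proof. by elim=> //= [f -> g ->|f -> g ->|f -> g ->|f ->]. Qed.

HB.instance Definition _ := Countable.copy code (pcan_type code_treeK).

(* Oracles are relations (graphs of partial functions). *)
Definition oracle := nat -> nat -> Prop.

(* Big-step semantics: eval a c x y  <->  program c with oracle a on input x *)
(* halts with output y.  Querying the oracle where it is undefined diverges.  *)
Inductive eval (a : oracle) : code -> nat -> nat -> Prop :=
  | ev_zero x : eval a CZero x 0
  | ev_succ x : eval a CSucc x x.+1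
  | ev_id x : eval a CId x x
  | ev_fst x y : eval a CFst (cpair x y) x
  | ev_snd x y : eval a CSnd (cpair x y) y
  | ev_pair f g x y z : eval a f x y -> eval a g x z -> eval a (CPair f g) x (cpair y z)
  | ev_comp f g x y z : eval a g x y -> eval a f y z -> eval a (CComp f g) x z
  | ev_prim0 f g x z : eval a f x z -> eval a (CPrim f g) (cpair x 0) z
  | ev_primS f g x y z w :
      eval a (CPrim f g) (cpair x y) z -> eval a g (cpair x (cpair y z)) w ->
      eval a (CPrim f g) (cpair x y.+1) w
  | ev_mu f x y :
      eval a f (cpair x y) 0 ->
      (forall z, z < y -> exists k, k <> 0 /\ eval a f (cpair x z) k) ->
      eval a (CMu f) x y
  | ev_oracle x y : a x y -> eval a COracle x y.

(* Phi_e^a(n) ~ m : the e-th Turing functional (e decoded via unpickle;      *)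
(* indices that decode to no program give the nowhere-defined functional).   *)
Definition Phi (e : nat) (a : oracle) (n m : nat) : Prop :=
  exists c : code, unpickle e = Some c /\ eval a c n m.

Definition pfun := nat -> option nat.

Definition graph (f : pfun) : oracle := fun n m => f n = Some m.

Definition pjoin (f g : pfun) : oracle := fun n m =>
  (exists k, n = k.*2 /\ f k = Some m) \/ (exists k, n = k.*2.+1 /\ g k = Some m).

Definition Bapp (f g h : pfun) : Prop :=
  forall n m, h n = Some m <-> exists e, f 0 = Some e /\ Phi e (pjoin f g) n m.

Definition chi (X : nat -> Prop) : oracle := fun n m =>
  (X n /\ m = 1) \/ (~ X n /\ m = 0).

Definition inBX (X : nat -> Prop) (f : pfun) : Prop :=
  exists e, forall n m, f n = Some m <-> Phi e (chi X) n m.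

Definition Gapp (A B : nat -> Prop) : nat -> Prop := fun n =>
  exists u, A (cpair n u) /\ (forall k, D u k -> B k).

Definition empty_oracle : oracle := fun _ _ => False.
Definition ce (A : nat -> Prop) : Prop :=
  exists e, forall n, A n <-> exists m, Phi e empty_oracle n m.

Inductive inGY (Y : nat -> Prop) : (nat -> Prop) -> Prop :=
  | GY_base : inGY Y Y
  | GY_ce A : ce A -> inGY Y A
  | GY_app A B : inGY Y A -> inGY Y B -> inGY Y (Gapp A B).

Definition join_compl (X : nat -> Prop) : nat -> Prop := fun k =>
  (exists n, k = n.*2 /\ X n) \/ (exists n, k = n.*2.+1 /\ ~ X n).

(* Main.v *)
(* Idea.  Let F(phi) be the least set containing <<i,j>,1> whenever phi(i) = j
   and <n,u> whenever u is even and n is in F(phi . q_u), where q_u is the finite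
   relation {(i,j) : <<i,j>,1> in D_u}.  By induction 0 is never in F(phi), and as
   D_1 = {0} the elements <<i,j>,1> store the graph of phi (whence injectivity)
   without contributing to an application.  That F(phi) . F(psi) = F(phi . psi)
   then is the continuity of F and of the application of B.

   By continuity again, F(Phi_e^X) = A . (X (+) complement X) for the set A of all
   <x,v> such that x is in F(Phi_e^o), o being the finite part of X coded by D_v.
   That A is c.e. means that programs of this particular language must interpret
   (pickled) programs.  To avoid writing an interpreter in the language, we only
   write in it a checker for derivations from an arbitrary finite list of Horn
   clauses over terms built from 0, successor and pairing; unpickling, evaluation
   and F are then axiomatised by Horn clauses. *)
Require Import Defs.
From mathcomp Require Import all_boot.
From Stdlib Require List.
From Stdlib Require Import FunctionalExtensionality PropExtensionality.

Set Implicit Arguments.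
Unset Strict Implicit.
Unset Printing Implicit Defensive.

Arguments cpair : simpl never.

(** * Cantor pairing and total computable functions *)

(** The successor in Cantor's enumeration along antidiagonals; iterating it inverts [cpair] without
    square roots. *)
Definition cantor_next (p : nat * nat) : nat * nat :=
  if p.1 is x.+1 then (x, p.2.+1) else (p.2.+1, 0).

Definition cunpair (n : nat) : nat * nat := iter n cantor_next (0, 0).

Definition cfst n := (cunpair n).1.
Definition csnd n := (cunpair n).2.

Lemma cpair_next p :
  cpair (cantor_next p).1 (cantor_next p).2 = (cpair p.1 p.2).+1.
Proof.
case: p => [[|x] y]; rewrite /cantor_next /cpair /fst /snd.
  rewrite !addn0 add0n; suff ->: y.+1 * y.+2 = y.+1.*2 + y * y.+1.
    by rewrite halfD odd_double doubleK /= add0n addSn addnC.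
  by rewrite -muln2 [y * _]mulnC -mulnDr.
by rewrite -addSnnS addnS.
Qed.

Lemma cfst_csndK n : cpair (cfst n) (csnd n) = n.
Proof. by elim: n => // n IHn; rewrite /cfst /csnd /= cpair_next IHn. Qed.

Lemma cpairK x y : cunpair (cpair x y) = (x, y).
Proof.
move En: (cpair x y) => n; elim: n x y En => [|n IHn] x y En.
  move: En; rewrite /cpair; case: y => [|y]; last by rewrite addnS.
  by case: x => // x; rewrite !addn0 mulSn mulnS addSn addnA halfD.
(* The code is a successor, so the pair is not (0, 0) and has a predecessor. *)
have [p Ep]: exists p, cantor_next p = (x, y).
  case: y En => [|y] En; last by exists (x.+1, y).
  by case: x En => // x _; exists (0, x).
case: p Ep => x0 y0 Ep; have := cpair_next (x0, y0); rewrite Ep En /=.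
by move=> -[/esym/IHn]; rewrite /cunpair /= => ->.
Qed.

Lemma cfstK x y : cfst (cpair x y) = x. Proof. by rewrite /cfst cpairK. Qed.
Lemma csndK x y : csnd (cpair x y) = y. Proof. by rewrite /csnd cpairK. Qed.
Definition cK := (cfstK, csndK).

Lemma cpair_inj x y x' y' : cpair x y = cpair x' y' -> x = x' /\ y = y'.
Proof.
by move=> E; move: (congr1 cfst E) (congr1 csnd E); rewrite !cK.
Qed.

Opaque cpair.

(** One code must serve every oracle; the equivalence expresses both termination and uniqueness of
    the output. *)
Definition comp (f : nat -> nat) : Prop :=
  exists c, forall a x y, eval a c x y <-> y = f x.

Lemma comp_ext f g : f =1 g -> comp f -> comp g.
Proof. by move=> fg [c Hc]; exists c => a x y; rewrite Hc fg. Qed.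

Lemma comp_id : comp id.
Proof. by exists CId => a x y; split=> [H|->]; [inversion H | constructor]. Qed.

Lemma comp_pair f g : comp f -> comp g -> comp (fun x => cpair (f x) (g x)).
Proof.
move=> [c Hc] [d Hd]; exists (CPair c d) => a x y; split=> [H|->].
  by inversion H; subst; f_equal; [apply/Hc; eassumption | apply/Hd; eassumption].
by constructor; [apply/Hc | apply/Hd].
Qed.

Lemma comp_comp f g : comp f -> comp g -> comp (fun x => f (g x)).
Proof.
move=> [c Hc] [d Hd]; exists (CComp c d) => a x y; split=> [H|->].
  inversion H as [| | | | | |? ? ? z ? Hg Hf| | | |]; subst.
  by move: Hg Hf => /Hd -> /Hc.
by apply: (@ev_comp _ _ _ _ (g x)); [apply/Hd | apply/Hc].
Qed.

Lemma comp_succ f : comp f -> comp (fun x => (f x).+1).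
Proof.
apply: (@comp_comp succn).
by exists CSucc => a x y; split=> [H|->]; [inversion H | constructor].
Qed.

Lemma comp_fst f : comp f -> comp (fun x => cfst (f x)).
Proof.
apply: comp_comp; exists CFst => a x y; split=> [H|->].
  by inversion H; rewrite cfstK.
by rewrite -{1}(cfst_csndK x); constructor.
Qed.

Lemma comp_snd f : comp f -> comp (fun x => csnd (f x)).
Proof.
apply: comp_comp; exists CSnd => a x y; split=> [H|->].
  by inversion H; rewrite csndK.
by rewrite -{1}(cfst_csndK x); constructor.
Qed.

Lemma comp_const k : comp (fun=> k).
Proof.
elim: k => [|k]; last exact: comp_succ.
by exists CZero => a x y; split=> [H|->]; [inversion H | constructor].
Qed.

Definition prim_rec (g h : nat -> nat) (x y : nat) : nat :=
  nat_rec (fun=> nat) (g x) (fun z r => h (cpair x (cpair z r))) y.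

Lemma comp_prim g h f k : comp g -> comp h -> comp f -> comp k ->
  comp (fun x => prim_rec g h (f x) (k x)).
Proof.
move=> [c Hc] [d Hd] Cf Ck.
pose p x := prim_rec g h (cfst x) (csnd x).
apply: (@comp_ext (fun x => p (cpair (f x) (k x)))) => [x|].
  by rewrite /p !cK.
apply: comp_comp; last exact: comp_pair.
exists (CPrim c d) => a x y; rewrite /p -{1}(cfst_csndK x).
move: (cfst x) (csnd x) => {}x n.
elim: n y => [|n IHn] y; (split=> [H|->]); last 1 first.
- by apply: ev_primS; [apply/IHn | apply/Hd].
- inversion H as [| | | | | | |? ? x' ? Hf E1 Ez E2|? ? ? ? ? ? ? ? E1 Ez E2| |];
    subst; last by case: (cpair_inj Ez).
  by move: (cpair_inj Ez) Hf => [-> _] /Hc.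
- by constructor; apply/Hc.
- inversion H as [| | | | | | |? ? ? ? ? E1 Ez E2|? ? ? n' r ? Hr Hs E1 Ez E2| |];
    subst; first by case: (cpair_inj Ez).
  by move: (cpair_inj Ez) Hr Hs => [-> [->]] /IHn -> /Hd.
Qed.

Lemma comp_iter s f k : comp s -> comp f -> comp k ->
  comp (fun x => iter (k x) s (f x)).
Proof.
move=> Cs Cf Ck.
have Ch: comp (fun x => s (csnd (csnd x))).
  by apply: comp_comp => //; apply/comp_snd/comp_snd/comp_id.
apply: comp_ext (comp_prim comp_id Ch Cf Ck) => x.
by elim: (k x) => //= n ->; rewrite !cK.
Qed.

Lemma comp_pred f : comp f -> comp (fun x => (f x).-1).
Proof.
move=> Cf.
have Ch: comp (fun x => cfst (csnd x)) by apply/comp_fst/comp_snd/comp_id.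
apply: comp_ext (comp_prim comp_id Ch (comp_const 0) Cf) => x.
by case: (f x) => //= n; rewrite !cK.
Qed.

Lemma comp_sub f g : comp f -> comp g -> comp (fun x => f x - g x).
Proof.
move=> Cf Cg; apply: comp_ext (comp_iter (comp_pred comp_id) Cf Cg) => x /=.
by elim: (g x) => [|n IHn] /=; rewrite ?subn0 // IHn subnS.
Qed.

Lemma comp_if0 b f g : comp b -> comp f -> comp g ->
  comp (fun x => if b x == 0 then f x else g x).
Proof.
move=> Cb Cf Cg.
have Ch: comp (fun x => g (cfst x)) by apply: comp_comp => //; apply/comp_fst/comp_id.
apply: comp_ext (comp_prim Cf Ch comp_id Cb) => x.
by case: (b x) => //= n; rewrite !cK.
Qed.

Lemma comp_eq b c f g : comp b -> comp c -> comp f -> comp g ->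
  comp (fun x => if b x == c x then f x else g x).
Proof.
move=> Cb Cc Cf Cg.
have Ci := comp_if0 (comp_sub Cb Cc) (comp_if0 (comp_sub Cc Cb) Cf Cg) Cg.
apply: comp_ext Ci => x.
by rewrite [b x == c x]eqn_leq -!subn_eq0; case: (b x - c x).
Qed.

(** * Sets derivable from finitely many Horn clauses are c.e. *)

Inductive term := V of nat | Zero | Suc of term | Pair of term & term.

Definition clause := (term * seq term)%type.

Fixpoint tval (r : nat -> nat) (t : term) : nat :=
  match t with
  | V i => r i
  | Zero => 0
  | Suc t => (tval r t).+1
  | Pair t u => cpair (tval r t) (tval r u)
  end.

Lemma eq_tval r r' t : r =1 r' -> tval r t = tval r' t.
Proof. by move=> E; elim: t => //= [t -> |t -> u ->]. Qed.

(** Environments are infinite lists coded by nested pairs. As 0 codes (0, 0), it also codes the zero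
    list, which agrees with the default of [nth 0]. *)
Definition lookup (e i : nat) : nat := cfst (iter i csnd e).

Definition encode_env (s : seq nat) : nat := foldr cpair 0 s.

Lemma lookup_encode s : lookup (encode_env s) =1 nth 0 s.
Proof.
elim: s => [|x s IHs] i /=; rewrite /lookup.
  suff -> : iter i csnd 0 = 0 by rewrite nth_nil.
  by elim: i => //= i ->.
by case: i => [|i]; rewrite ?iterSr /= !cK //; apply: IHs.
Qed.

Lemma comp_tval f t : comp f -> comp (fun x => tval (lookup (f x)) t).
Proof.
move=> Cf; elim: t => [i||t IHt|t IHt u IHu] /=.
- by apply: comp_fst; elim: i => //= i; apply: comp_snd.
- exact: comp_const.
- exact: comp_succ.
- exact: comp_pair.
Qed.

Section HornProgram.

Variable P : seq clause.

(** Each inference is named by two numbers, a clause index and an environment, so that derivations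
    can be searched for. *)
Inductive derives : nat -> Prop :=
  Derives i e : i < size P ->
    (forall t, List.In t (nth (Zero, [::]) P i).2 -> derives (tval (lookup e) t)) ->
    derives (tval (lookup e) (nth (Zero, [::]) P i).1).

(** On a concrete clause this computes to an explicit conjunction of the premises. *)
Fixpoint conj_all (A : nat -> Prop) (r : nat -> nat) (b : seq term) : Prop :=
  if b is t :: b' then A (tval r t) /\ conj_all A r b' else True.

Lemma derives_clause i s : i < size P ->
  conj_all derives (nth 0 s) (nth (Zero, [::]) P i).2 ->
  derives (tval (nth 0 s) (nth (Zero, [::]) P i).1).
Proof.
move=> ltiP Hb; rewrite -(eq_tval _ (lookup_encode s)); apply: Derives => // t.
elim: _.2 Hb => //= u b IHb [Hu /IHb{}IHb] [<-|//].
by rewrite (eq_tval _ (lookup_encode s)).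
Qed.

(** The [foldr] unfolds on a concrete program to one obligation per clause. *)
Lemma derives_sound (A : nat -> Prop) :
  foldr (fun c B => (forall r, conj_all A r c.2 -> A (tval r c.1)) /\ B) True P ->
  forall n, derives n -> A n.
Proof.
move=> HP n; elim=> i e lti _ IH; set c := nth _ _ _ in IH *.
have Hc: forall r, conj_all A r c.2 -> A (tval r c.1).
  rewrite /c; elim: P i HP lti {IH c} => // d Q IHQ [|i] [Hd HQ] lti //.
  exact: IHQ.
apply: Hc; elim: c.2 IH => //= t b IHb IH.
by split; [apply: IH; left | apply: IHb => u Hu; apply: IH; right].
Qed.

(* A stack of goals is coded by 0 (empty) and (cpair goal rest).+1. *)
Definition push (r : nat -> nat) (b : seq term) (s : nat) : nat :=
  foldr (fun t s => (cpair (tval r t) s).+1) s b.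

(** Recursion on the clauses gives a fixed nest of conditionals, whose computability follows by
    induction on the list. *)
Fixpoint try_clause (cs : seq clause) (i e g s fail : nat) : nat :=
  if cs is c :: cs' then
    if i == 0 then
      if tval (lookup e) c.1 == g then push (lookup e) c.2 s else fail
    else try_clause cs' i.-1 e g s fail
  else fail.

(* A state is (choices, stack); a choice is (clause index, environment), and a
   wrong choice is skipped. *)
Definition step (st : nat) : nat :=
  cpair (csnd (cfst st))
    (try_clause P (cfst (cfst (cfst st))) (csnd (cfst (cfst st)))
       (cfst (csnd st).-1) (csnd (csnd st).-1) (csnd st)).

Lemma comp_push f h b : comp f -> comp h ->
  comp (fun x => push (lookup (f x)) b (h x)).
Proof.
by move=> Cf Ch; elim: b => //= t b IHb; apply/comp_succ/comp_pair/IHb/comp_tval.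
Qed.

Lemma comp_try_clause cs k e g s f :
  comp k -> comp e -> comp g -> comp s -> comp f ->
  comp (fun x => try_clause cs (k x) (e x) (g x) (s x) (f x)).
Proof.
move=> Ck Ce Cg Cs Cf; elim: cs k Ck => [|c cs IHcs] k Ck //=.
apply: comp_if0 => //; last by apply: (IHcs (fun x => (k x).-1)); apply: comp_pred.
by apply: comp_eq => //; [apply: comp_tval | apply: comp_push].
Qed.

Lemma comp_step : comp step.
Proof.
have Cfst := comp_fst comp_id; have Csnd := comp_snd comp_id.
have Cpred := comp_pred Csnd.
have Cff := comp_fst Cfst.
apply: comp_pair; first exact: comp_snd.
apply: comp_try_clause => //; try exact: comp_fst; exact: comp_snd.
Qed.

Lemma try_clauseE cs i e g s fail :
  let c := nth (Zero, [::]) cs i in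
  try_clause cs i e g s fail =
    if (i < size cs) && (tval (lookup e) c.1 == g) then push (lookup e) c.2 s
    else fail.
Proof. by elim: cs i => [|c cs IHcs] [|i] //=; rewrite IHcs. Qed.

Inductive stack_ok : nat -> Prop :=
  | stack_nil : stack_ok 0
  | stack_cons g s : derives g -> stack_ok s -> stack_ok (cpair g s).+1.

Lemma push_ok r b s : stack_ok (push r b s) ->
  (forall t, List.In t b -> derives (tval r t)) /\ stack_ok s.
Proof.
elim: b => //= t b IHb H; inversion H as [|g s' dg os E].
case: (cpair_inj E) => ? ?; subst; have [Hb ?] := IHb os.
by split=> // u [<-|/Hb].
Qed.

(** The invariant is pulled back along steps: the goals pushed are the premises of the goal
    removed. *)
Lemma step_ok st : stack_ok (csnd (step st)) -> stack_ok (csnd st).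
Proof.
rewrite /step csndK try_clauseE; case: (csnd st) => [|s] /=.
  (* On the empty stack [step] takes 0 for the goal; this is harmless, since the empty stack is
     acceptable anyway. *)
  by move=> _; constructor.
case: ifP => // /andP[lti /eqP Eg] /push_ok[Hb Hs].
by rewrite -(cfst_csndK s); constructor; rewrite // -Eg; apply: Derives.
Qed.

Lemma iter_step_ok n st : csnd (iter n step st) = 0 -> stack_ok (csnd st).
Proof.
elim: n st => [|n IHn] st; first by move=> /= ->; constructor.
by rewrite iterSr => /IHn/step_ok.
Qed.

(** Quantifying over [d] and [s] lets runs be concatenated: the choices for [g] are put in front of
    [d], and [s] stays untouched below [g]. *)
Lemma derives_run g : derives g -> forall d s, exists d' n,
  iter n step (cpair d' (cpair g s).+1) = cpair d s.
Proof.
elim=> i e lti _ IHb d s.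
have [d' [n En]]: exists d' n, iter n step
    (cpair d' (push (lookup e) (nth (Zero, [::]) P i).2 s)) = cpair d s.
  elim: _.2 IHb => [|t b IHt] IHb /=; first by exists d, 0.
  (* The choices for the later premises come first, because those for [t] are then put in front of
     them. *)
  have [d1 [n1 E1]] := IHt (fun u Hu => IHb u (or_intror Hu)).
  have [d2 [n2 E2]] := IHb t (or_introl erefl) d1 (push (lookup e) b s).
  by exists d2, (n1 + n2); rewrite iterD E2.
exists (cpair (cpair i e) d'), n.+1.
by rewrite iterSr /step !(cK, succnK) try_clauseE lti eqxx.
Qed.

(** The number [d] is a certificate: a number of steps paired with a list of choices. *)
Lemma derivesE g : derives g <->
  exists d, csnd (iter (cfst d) step (cpair (csnd d) (cpair g 0).+1)) = 0.
Proof.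
split=> [/derives_run/(_ 0 0)[d [n E]]|[d /iter_step_ok]].
  by exists (cpair n d); rewrite !cK E csndK.
rewrite csndK => H; inversion H as [|g' s' dg _ E].
by case: (cpair_inj E) => <-.
Qed.

Lemma ce_derives t : comp t -> ce (fun n => derives (t n)).
Proof.
move=> Ct.
pose h x := csnd (iter (cfst (csnd x)) step
                    (cpair (csnd (csnd x)) (cpair (t (cfst x)) 0).+1)).
have [c Hc]: comp h.
  apply/comp_snd/comp_iter; first exact: comp_step.
    apply: comp_pair; first by do 2!apply: comp_snd; apply: comp_id.
    apply/comp_succ/comp_pair/comp_const.
    by apply: comp_comp => //; apply/comp_fst/comp_id.
  by apply/comp_fst/comp_snd/comp_id.
(* The unbounded search for a certificate halts exactly on the derivable judgements. *)
exists (pickle (CMu c)) => n; rewrite derivesE; split=> [ex|].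
  have {}ex: exists d, h (cpair n d) == 0.
    by case: ex => d Hd; exists d; rewrite /h !cK Hd.
  exists (ex_minn ex), (CMu c); split; first exact: pickleK.
  case: ex_minnP => m /eqP hm minm; constructor=> [|z ltzm].
    exact/Hc/esym.
  exists (h (cpair n z)); split; last exact/Hc.
  by move=> /eqP /minm; rewrite leqNgt ltzm.
case=> m [c' []]; rewrite pickleK => -[<-] H.
inversion H as [| | | | | | | | |? ? ? H0 H1|].
by exists m; move: H0 => /Hc; rewrite /h !cK.
Qed.

End HornProgram.

(** * Continuity of oracle computation *)

(** The generated induction principle gives no hypothesis for the evaluations nested under [exists]
    in [ev_mu]. *)
Lemma eval_nested_ind (a : oracle) (Q : code -> nat -> nat -> Prop) :
  (forall x, Q CZero x 0) ->
  (forall x, Q CSucc x x.+1) ->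
  (forall x, Q CId x x) ->
  (forall x y, Q CFst (cpair x y) x) ->
  (forall x y, Q CSnd (cpair x y) y) ->
  (forall f g x y z, Q f x y -> Q g x z -> Q (CPair f g) x (cpair y z)) ->
  (forall f g x y z, Q g x y -> Q f y z -> Q (CComp f g) x z) ->
  (forall f g x z, Q f x z -> Q (CPrim f g) (cpair x 0) z) ->
  (forall f g x y z w, Q (CPrim f g) (cpair x y) z ->
     Q g (cpair x (cpair y z)) w -> Q (CPrim f g) (cpair x y.+1) w) ->
  (forall f x y, Q f (cpair x y) 0 ->
     (forall z, z < y -> exists k, k <> 0 /\ Q f (cpair x z) k) ->
     Q (CMu f) x y) ->
  (forall x y, a x y -> Q COracle x y) ->
  forall c x y, eval a c x y -> Q c x y.
Proof.
move=> H0 H1 H2 H3 H4 H5 H6 H7 H8 H9 H10.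
fix IH 4 => c x y [] {c x y} *; eauto.
apply: H9; first exact: IH.
move=> z ltz; match goal with H : forall z, _ |- _ =>
  case: (H z ltz) => k [k0 Hk]; exists k; split; [exact: k0 | exact: IH] end.
Qed.

Definition incl (a b : oracle) : Prop := forall n m, a n m -> b n m.

Definition rel_of (s : seq nat) : oracle := fun n m => cpair n m \in s.

Lemma incl_catl s t : incl (rel_of s) (rel_of (s ++ t)).
Proof. by move=> n m; rewrite /rel_of mem_cat => ->. Qed.

Lemma incl_catr s t : incl (rel_of t) (rel_of (s ++ t)).
Proof. by move=> n m; rewrite /rel_of mem_cat orbC => ->. Qed.

Lemma incl_cat s t a :
  incl (rel_of s) a -> incl (rel_of t) a -> incl (rel_of (s ++ t)) a.
Proof. by move=> Hs Ht n m; rewrite /rel_of mem_cat => /orP[/Hs|/Ht]. Qed.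

(* Scott continuity of a predicate on partial (multi-valued) functions. *)
Definition continuous (Op : oracle -> Prop) : Prop :=
  (forall a b, incl a b -> Op a -> Op b) /\
  (forall a, Op a -> exists s, incl (rel_of s) a /\ Op (rel_of s)).

Lemma continuous_const (A : Prop) : continuous (fun=> A).
Proof. by split=> // a HA; exists [::]. Qed.

Lemma continuous_at i j : continuous (fun a => a i j).
Proof.
split=> [a b sab|a aij]; first exact: sab.
exists [:: cpair i j]; rewrite /rel_of inE eqxx; split=> // n m.
by rewrite inE => /eqP/cpair_inj[-> ->].
Qed.

Lemma continuous_and Op1 Op2 : continuous Op1 -> continuous Op2 ->
  continuous (fun a => Op1 a /\ Op2 a).
Proof.
move=> [M1 C1] [M2 C2]; split=> [a b sab [/M1 O1 /M2 O2]|a [/C1[s [Ss Os]] /C2[t [St Ot]]]].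
  by split; [apply: O1 | apply: O2].
exists (s ++ t); split; first exact: incl_cat.
split; first exact: M1 (@incl_catl _ _) Os.
exact: M2 (@incl_catr _ _) Ot.
Qed.

Lemma continuous_or Op1 Op2 : continuous Op1 -> continuous Op2 ->
  continuous (fun a => Op1 a \/ Op2 a).
Proof.
move=> [M1 C1] [M2 C2]; split=> [a b sab [/M1|/M2] O|a [/C1|/C2] [s [Ss Os]]].
- by left; apply: O.
- by right; apply: O.
- by exists s; split=> //; left.
- by exists s; split=> //; right.
Qed.

Lemma continuous_ex T (Op : T -> oracle -> Prop) :
  (forall k, continuous (Op k)) -> continuous (fun a => exists k, Op k a).
Proof.
move=> C; split=> [a b sab [k Ok]|a [k /(proj2 (C k))[s [Ss Os]]]].
  by exists k; apply: (proj1 (C k)) Ok.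
by exists s; split=> //; exists k.
Qed.

Lemma continuous_all (T : eqType) (s : seq T) (Op : T -> oracle -> Prop) :
  (forall k, continuous (Op k)) ->
  continuous (fun a => forall k, k \in s -> Op k a).
Proof.
move=> C; split=> [a b sab Ok k /Ok|a]; first exact: (proj1 (C k)).
elim: s => [|k s IHs] Oa; first by exists [::].
have [l [Sl Ol]] := proj2 (C k) a (Oa k (mem_head _ _)).
have [t [St Ot]] := IHs (fun k' Hk' => Oa k' (mem_behead (s := k :: s) Hk')).
exists (l ++ t); split; first exact: incl_cat.
move=> k'; rewrite inE => /predU1P[->|/Ot].
  exact: (proj1 (C k)) (@incl_catl _ _) Ol.
exact: (proj1 (C k')) (@incl_catr _ _).
Qed.

(** A finite part of [G a] has finitely many pairs, each secured by a finite part of [a]. *)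
Lemma continuous_comp (Op : oracle -> Prop) (G : oracle -> oracle) :
  continuous Op -> (forall i j, continuous (fun a => G a i j)) ->
  continuous (fun a => Op (G a)).
Proof.
move=> [M C] CG; split=> [a b sab|a /C[s [Ss Os]]].
  by apply: M => n m; apply: (proj1 (CG n m)).
have Cs := @continuous_all _ s _ (fun k => CG (cfst k) (csnd k)).
have [k ks|t [St Ot]] := proj2 Cs a.
  by apply: Ss; rewrite /rel_of cfst_csndK.
exists t; split=> //; apply: M Os => n m /Ot.
by rewrite !cK.
Qed.

Lemma eval_mono a b c x y : incl a b -> eval a c x y -> eval b c x y.
Proof.
move=> sab; move: c x y; apply: eval_nested_ind; by econstructor; eauto.
Qed.

Lemma continuous_eval c x y : continuous (fun a => eval a c x y).
Proof.
split=> [a b|a]; first exact: eval_mono.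
have M s t c' x' y' := @eval_mono _ _ c' x' y' (@incl_catl s t).
have M' s t c' x' y' := @eval_mono _ _ c' x' y' (@incl_catr s t).
move: c x y; apply: eval_nested_ind; try by exists [::]; split=> //; constructor.
- move=> f g x y z [s [Ss Es]] [t [St Et]]; exists (s ++ t).
  by split; [apply: incl_cat | constructor; [apply: M | apply: M']].
- move=> f g x y z [s [Ss Es]] [t [St Et]]; exists (s ++ t).
  by split; [apply: incl_cat | apply: ev_comp; [apply: M Es | apply: M' Et]].
- by move=> f g x z [s [Ss Es]]; exists s; split=> //; constructor.
- move=> f g x y z w [s [Ss Es]] [t [St Et]]; exists (s ++ t).
  by split; [apply: incl_cat | apply: ev_primS; [apply: M Es | apply: M' Et]].
- move=> f x y [s [Ss Es]] H.
  (* The finite parts used for the finitely many [z < y] are merged into one. *)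
  have [t [St Et]]: exists t, incl (rel_of t) a /\
      forall z, z < y -> exists k, k <> 0 /\ eval (rel_of t) f (cpair x z) k.
    elim: y {s Ss Es} H => [|y IHy] H; first by exists [::].
    have [t [St Et]] := IHy (fun z ltz => H z (ltnW ltz)).
    have [k [k0 [s [Ss Es]]]] := H y (ltnSn y).
    exists (s ++ t); split; first exact: incl_cat.
    move=> z; rewrite ltnS leq_eqVlt => /predU1P[->|/Et[k' [k0' Ek']]].
      by exists k; split=> //; apply: M.
    by exists k'; split=> //; apply: M'.
  exists (s ++ t); split; first exact: incl_cat.
  constructor; first exact: M.
  by move=> z /Et[k [k0 Ek]]; exists k; split=> //; apply: M'.
- move=> x y axy; have [s [Ss Es]] := proj2 (continuous_at x y) a axy.
  by exists s; split=> //; constructor.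
Qed.

(** Join and application are extended to arbitrary relations, since [decode_rel u] need not be
    single-valued. *)
Definition join_rel (R Q : oracle) : oracle := fun n m =>
  (exists k, n = k.*2 /\ R k m) \/ (exists k, n = k.*2.+1 /\ Q k m).

Definition app_rel (R Q : oracle) : oracle := fun n m =>
  exists e, R 0 e /\ Phi e (join_rel R Q) n m.

Lemma continuous_Phi e n m : continuous (fun a => Phi e a n m).
Proof.
apply: continuous_ex => c; apply: continuous_and; first exact: continuous_const.
exact: continuous_eval.
Qed.

Lemma continuous_joinl Q n m : continuous (fun R => join_rel R Q n m).
Proof.
apply: continuous_or; last exact: continuous_const.
apply: continuous_ex => k; apply: continuous_and; first exact: continuous_const.
exact: continuous_at.
Qed.

Lemma continuous_joinr R n m : continuous (fun Q => join_rel R Q n m).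
Proof.
apply: continuous_or; first exact: continuous_const.
apply: continuous_ex => k; apply: continuous_and; first exact: continuous_const.
exact: continuous_at.
Qed.

Lemma continuous_appl Q n m : continuous (fun R => app_rel R Q n m).
Proof.
apply: continuous_ex => e; apply: continuous_and; first exact: continuous_at.
apply: (continuous_comp (continuous_Phi e n m)) => i j; exact: continuous_joinl.
Qed.

Lemma continuous_appr R n m : continuous (fun Q => app_rel R Q n m).
Proof.
apply: continuous_ex => e; apply: continuous_and; first exact: continuous_const.
apply: (continuous_comp (continuous_Phi e n m)) => i j; exact: continuous_joinr.
Qed.

(** * The embedding *)

Definition decode_rel (u : nat) : oracle := fun i j => D u (cpair (cpair i j) 1).

(** Even codes are written [a.*2]; they differ from 1, which keeps the two kinds of elements
    apart. *)
Inductive emb : oracle -> nat -> Prop :=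
  | emb_graph R i j : R i j -> emb R (cpair (cpair i j) 1)
  | emb_app R n a :
      emb (app_rel R (decode_rel a.*2)) n -> emb R (cpair n a.*2).

Lemma emb_mono R R' x : incl R R' -> emb R x -> emb R' x.
Proof.
move=> sR H; elim: H R' sR => {R x} [R i j Rij|R n a _ IH] R' sR.
  by constructor; apply: sR.
by constructor; apply: IH => i j; apply: (proj1 (continuous_appl _ i j)).
Qed.

Lemma continuous_emb x : continuous (fun R => emb R x).
Proof.
split=> [R R'|R]; first exact: emb_mono.
elim=> {R x} [R i j Rij|R n a _ [s [Ss Es]]].
  have [s [Ss Es]] := proj2 (continuous_at i j) R Rij.
  by exists s; split=> //; constructor.
(* The finite part [s] of the application is itself secured by a finite part of [R]. *)
have Cs := @continuous_all _ s _ (fun k =>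
  continuous_appl (decode_rel a.*2) (cfst k) (csnd k)).
have [k ks|t [St Ot]] := proj2 Cs R.
  by apply: Ss; rewrite /rel_of cfst_csndK.
exists t; split=> //; constructor; apply: emb_mono Es => i j /Ot.
by rewrite !cK.
Qed.

(** * Binary codes of finite sets *)

Lemma nat_oddE n : Nat.odd n = odd n.
Proof.
suff: Nat.odd n = odd n /\ Nat.odd n.+1 = odd n.+1 by case.
by elim: n => // n [IH1 IH2]; split=> //=; rewrite negbK -IH1.
Qed.

Lemma nat_div2E n : Nat.div2 n = n./2.
Proof.
suff: Nat.div2 n = n./2 /\ Nat.div2 n.+1 = n.+1./2 by case.
by elim: n => // n [IH1 IH2]; split=> //=; rewrite IH1.
Qed.

Lemma testbit0 a : Nat.testbit a 0 = odd a.
Proof. exact: nat_oddE. Qed.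

Lemma testbitS a n : Nat.testbit a n.+1 = Nat.testbit a./2 n.
Proof. by rewrite -nat_div2E. Qed.

Lemma finite_code (s : seq nat) : exists u, forall k, D u k <-> k \in s.
Proof.
rewrite /D; elim: s => [|j s [u Hu]].
  by exists 0; elim=> // k; rewrite testbitS.
(* Adding [j] to the set amounts to setting bit [j] of [u]. *)
suff [v Hv]: exists v, forall k, Nat.testbit v k = (k == j) || Nat.testbit u k.
  exists v => k; rewrite Hv inE; split=> [/predU1P[->|/Hu ->]|/predU1P[->|/Hu ->]];
    by rewrite ?eqxx ?orbT.
elim: j u {Hu s} => [|j IHj] u.
  exists (true + u./2.*2) => -[|k]; first by rewrite testbit0 oddD odd_double.
  by rewrite !testbitS half_bit_double.
have [v Hv] := IHj u./2; exists (odd u + v.*2) => -[|k].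
  by rewrite !testbit0 oddD odd_double addbF; case: (odd u).
by rewrite !testbitS half_bit_double Hv.
Qed.

(** * Injectivity and compatibility with application *)

Lemma emb_graph_inv R x : emb R x -> forall i j, x = cpair (cpair i j) 1 -> R i j.
Proof.
case=> {R x} [R i j Rij|R n a _] i' j' E; last first.
  by case: (cpair_inj E) => _ /(congr1 odd); rewrite odd_double.
by case: (cpair_inj E) => /cpair_inj[<- <-].
Qed.

Lemma emb_graphE R i j : emb R (cpair (cpair i j) 1) <-> R i j.
Proof. by split=> [/emb_graph_inv/(_ _ _ erefl)|]; last constructor. Qed.

(** As 0 codes (0, 0), its second component is not 1, and [emb_app] would require a shorter
    derivation of 0 itself, for another relation. *)
Lemma emb0 R : ~ emb R 0.
Proof.
move: {-2}0 (erefl 0) => x Ex H; elim: H Ex => {R x} [R i j _|R n a _ IH] E.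
  by have := congr1 csnd E; rewrite !cK.
by apply: IH; have := congr1 cfst E; rewrite !cK.
Qed.

(* Since 0 is never in the image, the elements [emb_graph] are inert in an
   application: their second component 1 codes the set {0}. *)
Lemma emb_app_rel R Q : Gapp (emb R) (emb Q) = emb (app_rel R Q).
Proof.
apply: functional_extensionality => n; apply: propositional_extensionality.
split=> [[u [H]]|].
  move Ex: (cpair n u) H => x H; case: H Ex => {R x} [R i j _|R n' a Hn] Ex Hu.
    case: (@emb0 Q); apply: Hu; case: (cpair_inj Ex) => _ ->; exact: erefl.
  case: (cpair_inj Ex) => ? ?; subst n' u; apply: emb_mono Hn => i j.
  by apply: (proj1 (continuous_appr _ i j)) => i' j' /Hu/emb_graphE.
move=> H.
have Cn := continuous_comp (continuous_emb n) (continuous_appr R).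
have [s [Ss Es]] := proj2 Cn Q H.
(* This [u] codes the elements of [emb Q] that store the finite part [s] of [Q]. *)
have [u Hu] := finite_code [seq cpair k 1 | k <- s].
(* [u] is even: 0 has second component 0, so it is none of the pairs [cpair k 1]. *)
have Eu: u = u./2.*2.
  rewrite -{1}[u]odd_double_half -testbit0.
  suff: ~ D u 0 by rewrite /D; case: Nat.testbit.
  by move=> /Hu/mapP[k _ /(congr1 csnd)]; rewrite !cK.
exists u; split=> [|k /Hu/mapP[l sl ->]].
  rewrite Eu; constructor; rewrite -Eu; apply: emb_mono Es => i j.
  apply: (proj1 (continuous_appr _ i j)) => i' j' sij.
  by apply/Hu; apply: map_f.
by rewrite -(cfst_csndK l); constructor; apply: Ss; rewrite /rel_of cfst_csndK.
Qed.

(** * Horn clauses for the embedding *)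

(* MathComp's [unpickle] at type [nat + nat], the alphabet into which trees are
   serialised. *)
Definition sum_of_nat (n : nat) : option (nat + nat) :=
  if CodeSeq.decode n is [:: a; b] then
    sum_of_opair (ohead (CodeSeq.decode a), ohead (CodeSeq.decode b))
  else None.

Lemma pmap_Some (T : Type) (s : seq T) : pmap some s = s.
Proof. by elim: s => //= x s ->. Qed.

Lemma unpickle_sumE : @unpickle (nat + nat)%type =1 sum_of_nat.
Proof.
have E n : @unpickle (nat + nat)%type n = obind sum_of_opair
  (omap pair_of_tag (@unpickle_tagged (option nat) (fun=> option nat) n)) by [].
(* An option is pickled as a sequence of at most one entry. *)
have Eo n : @unpickle (option nat) n = Some (ohead (CodeSeq.decode n)).
  by rewrite -[in RHS](pmap_Some (CodeSeq.decode n)).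
move=> n; rewrite {}E /unpickle_tagged /sum_of_nat.
case: CodeSeq.decode => [|a [|b []]] //.
by rewrite (Eo a) (Eo b).
Qed.

(** The state of MathComp's tree decoder after reading all letters from the right: the trees of the
    current level, and those set aside at the enclosing levels. *)
Definition stack_of (n : nat) : seq (GenTree.tree nat) * seq (seq (GenTree.tree nat)) :=
  foldr (@GenTree.decode_step nat) ([::], [::])
    (pmap sum_of_nat (CodeSeq.decode n)).

Lemma unpickle_codeE e : @unpickle code e = obind tree_to_code (ohead (stack_of e).1).
Proof. by rewrite /stack_of -(eq_pmap unpickle_sumE). Qed.

Definition enc_seq (T : Type) (f : T -> nat) (s : seq T) : nat :=
  foldr (fun x r => (cpair (f x) r).+1) 0 s.

Fixpoint enc_tree (t : GenTree.tree nat) : nat :=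
  match t with
  | GenTree.Leaf x => cpair 0 x
  | GenTree.Node n f => cpair n.+1 (enc_seq enc_tree f)
  end.

Definition enc_stack (st : seq (GenTree.tree nat) * seq (seq (GenTree.tree nat))) :=
  cpair (enc_seq enc_tree st.1) (enc_seq (enc_seq enc_tree) st.2).

Definition enc_code (c : code) : nat := enc_tree (code_to_tree c).

Definition enc_sum (o : option (nat + nat)) : nat :=
  match o with
  | None => 0
  | Some (inr y) => cpair 1 y
  | Some (inl x) => cpair 2 x
  end.

(** Injectivity is asked only at the codes of programs, so induction on the program replaces a
    nested induction on trees. *)
Lemma enc_code_tree c t : enc_tree t = enc_code c -> t = code_to_tree c.
Proof.
have S1 (s : seq (GenTree.tree nat)) : enc_seq enc_tree s = 0 -> s = [::] by case: s.
rewrite /enc_code; elim: c t => [|||||f IHf g IHg|f IHf g IHg|f IHf g IHg|f IHf|] [x|n s] /=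
  /cpair_inj[] // [->]; try by move=> /S1 ->.
- by case: s => [|t [|u s]] //= [/cpair_inj[/IHf -> //]] [/cpair_inj[/IHg -> /S1 ->]].
- by case: s => [|t [|u s]] //= [/cpair_inj[/IHf -> //]] [/cpair_inj[/IHg -> /S1 ->]].
- by case: s => [|t [|u s]] //= [/cpair_inj[/IHf -> //]] [/cpair_inj[/IHg -> /S1 ->]].
- by case: s => [|t s] //= [/cpair_inj[/IHf -> /S1 ->]].
Qed.

Lemma tree_to_codeK t c : tree_to_code t = Some c -> code_to_tree c = t.
Proof.
elim: c t => [|||||f IHf g IHg|f IHf g IHg|f IHf g IHg|f IHf|] [//|n s];
  do 10 try case: n => [|n]; case: s => [|t [|u [|? s]]] //=;
  case Et: (tree_to_code t) => [f'|] //;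
  try (case Eu: (tree_to_code u) => [g'|] //);
  by case=> E1; try move=> E2; rewrite ?(IHf t) ?(IHg u) ?Et ?Eu ?E1 ?E2.
Qed.

(** This turns list decoding into the arithmetic that [tpow] axiomatises. *)
Lemma decode_cons v m : CodeSeq.decode (2 ^ v * m.*2.+1) = v :: CodeSeq.decode m.
Proof. by rewrite -[m in LHS]CodeSeq.decodeK; exact: (CodeSeq.codeK (v :: _)). Qed.

(* The part of a characteristic function determined by the subset [D v] of
   [join_compl X]. *)
Definition base_rel (v : nat) : oracle := fun i j =>
  (j = 1 /\ D v i.*2) \/ (j = 0 /\ D v i.*2.+1).

(* The relations occurring in the unfolding of [emb (Phi e (base_rel v))]. *)
Inductive context :=
  | Base of nat
  | Join of context & nat
  | Func of nat & context
  | App of context & nat.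

Fixpoint oracle_of (G : context) : oracle :=
  match G with
  | Base v => base_rel v
  | Join G u => join_rel (oracle_of G) (decode_rel u)
  | Func e G => Phi e (oracle_of G)
  | App G u => app_rel (oracle_of G) (decode_rel u)
  end.

Fixpoint enc_context (G : context) : nat :=
  match G with
  | Base v => cpair 0 v
  | Join G u => cpair 1 (cpair (enc_context G) u)
  | Func e G => cpair 2 (cpair e (enc_context G))
  | App G u => cpair 3 (cpair (enc_context G) u)
  end.

(** The first component tags the kind of judgement; the terms [tdbl] to [temb] take these values. *)
Definition jdbl a b := cpair 1 (cpair a b).
Definition jbit u k := cpair 2 (cpair u k).
Definition jpow v m k := cpair 3 (cpair v (cpair m k)).
Definition jsum v r := cpair 4 (cpair v r).
Definition jstack k st := cpair 5 (cpair k st).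
Definition jcode c := cpair 6 c.
Definition jeval G c x y := cpair 7 (cpair G (cpair c (cpair x y))).
Definition jbelow G c x y := cpair 8 (cpair G (cpair c (cpair x y))).
Definition janswer G i j := cpair 9 (cpair G (cpair i j)).
Definition jemb G x := cpair 10 (cpair G x).

(* Judgements about numbers coding no context or no program are vacuous; this is
   why clause 46 below needs a premise [tcode]. *)
Definition meaning (n : nat) : Prop :=
  let a := cfst (csnd n) in
  let b := csnd (csnd n) in
  match cfst n with
  | 1 => b = a.*2
  | 2 => D a b
  | 3 => csnd b = 2 ^ a * (cfst b).*2.+1
  | 4 => b = enc_sum (sum_of_nat a)
  | 5 => b = enc_stack (stack_of a)
  | 6 => exists c, enc_code c = csnd n
  | 7 => forall G c, enc_context G = a -> enc_code c = cfst b ->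
      eval (oracle_of G) c (cfst (csnd b)) (csnd (csnd b))
  | 8 => forall G c, enc_context G = a -> enc_code c = cfst b ->
      forall z, z < csnd (csnd b) ->
      exists k, k <> 0 /\ eval (oracle_of G) c (cpair (cfst (csnd b)) z) k
  | 9 => forall G, enc_context G = a -> oracle_of G (cfst b) (csnd b)
  | 10 => forall G, enc_context G = a -> emb (oracle_of G) b
  | _ => True
  end.

Fixpoint num (n : nat) : term := if n is n'.+1 then Suc (num n') else Zero.
Definition tcons (h t : term) : term := Suc (Pair h t).
Definition tdbl a b := Pair (num 1) (Pair a b).
Definition tbit u k := Pair (num 2) (Pair u k).
Definition tpow v m k := Pair (num 3) (Pair v (Pair m k)).
Definition tsum v r := Pair (num 4) (Pair v r).
Definition tstack k st := Pair (num 5) (Pair k st).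
Definition tcode c := Pair (num 6) c.
Definition teval G c x y := Pair (num 7) (Pair G (Pair c (Pair x y))).
Definition tbelow G c x y := Pair (num 8) (Pair G (Pair c (Pair x y))).
Definition tanswer G i j := Pair (num 9) (Pair G (Pair i j)).
Definition temb G x := Pair (num 10) (Pair G x).

Definition tjoin G u := Pair (num 1) (Pair G u).
Definition tfunc e G := Pair (num 2) (Pair e G).
Definition tapp G u := Pair (num 3) (Pair G u).

(** Here [k] is one more than the node label in [code_to_tree], as [enc_tree] reserves the tag 0 for
    leaves. *)
Definition tnullary k := Pair (num k) Zero.
Definition tunary k f := Pair (num k) (tcons f Zero).
Definition tbinary k f g := Pair (num k) (tcons f (tcons g Zero)).

(* The clauses are numbered since [use_clause] refers to them by position. *)
Definition program : seq clause :=
  let a := V 0 in let b := V 1 in let c := V 2 in let d := V 3 in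
  let m := V 4 in let n := V 5 in
  let G := V 0 in let f := V 1 in let g := V 2 in
  let x := V 3 in let y := V 4 in let z := V 5 in let w := V 6 in
  [::
    (* 0 *)  (tdbl Zero Zero, [::]);
    (* 1 *)  (tdbl (Suc a) (Suc (Suc b)), [:: tdbl a b]);
    (* 2 *)  (tbit (Suc b) Zero, [:: tdbl a b]);
    (* 3 *)  (tbit b (Suc c), [:: tdbl a b; tbit a c]);
    (* 4 *)  (tbit (Suc b) (Suc c), [:: tdbl a b; tbit a c]);
    (* 5 *)  (tpow Zero a (Suc b), [:: tdbl a b]);
    (* 6 *)  (tpow (Suc c) d b, [:: tdbl a b; tpow c d a]);
    (* 7 *)  (tsum Zero Zero, [::]);
    (* 8 *)  (tsum a Zero, [:: tpow b Zero a]);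
    (* 9 *)  (tsum a Zero, [:: tpow b c a; tpow d (Suc m) c]);
    (* 10 *) (tsum a (Pair (num 1) m),
               [:: tpow b c a; tpow d Zero c; tpow m n d]);
    (* 11 *) (tsum a (Pair (num 2) m),
               [:: tpow b c a; tpow Zero Zero c; tpow m n b]);
    (* 12 *) (tsum a Zero, [:: tpow Zero c a; tpow Zero Zero c]);
    (* 13 *) (tstack Zero (Pair Zero Zero), [::]);
    (* 14 *) (tstack a d, [:: tpow b c a; tsum b Zero; tstack c d]);
    (* 15 *) (tstack a (Pair (tcons (Pair Zero n) d) m),
               [:: tpow b c a; tsum b (Pair (num 1) n); tstack c (Pair d m)]);
    (* 16 *) (tstack a (Pair Zero (tcons d m)),
               [:: tpow b c a; tsum b (Pair (num 2) Zero); tstack c (Pair d m)]);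
    (* 17 *) (tstack a (Pair (tcons (Pair (Suc n) d) Zero) Zero),
               [:: tpow b c a; tsum b (Pair (num 2) (Suc n));
                   tstack c (Pair d Zero)]);
    (* 18 *) (tstack a (Pair (tcons (Pair (Suc n) d) m) w),
               [:: tpow b c a; tsum b (Pair (num 2) (Suc n));
                   tstack c (Pair d (tcons m w))]);
    (* 19 *) (tcode (tnullary 1), [::]);
    (* 20 *) (tcode (tnullary 2), [::]);
    (* 21 *) (tcode (tnullary 3), [::]);
    (* 22 *) (tcode (tnullary 4), [::]);
    (* 23 *) (tcode (tnullary 5), [::]);
    (* 24 *) (tcode (tbinary 6 f g), [:: tcode f; tcode g]);
    (* 25 *) (tcode (tbinary 7 f g), [:: tcode f; tcode g]);
    (* 26 *) (tcode (tbinary 8 f g), [:: tcode f; tcode g]);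
    (* 27 *) (tcode (tunary 9 f), [:: tcode f]);
    (* 28 *) (tcode (tnullary 10), [::]);
    (* 29 *) (teval G (tnullary 1) x Zero, [::]);
    (* 30 *) (teval G (tnullary 2) x (Suc x), [::]);
    (* 31 *) (teval G (tnullary 3) x x, [::]);
    (* 32 *) (teval G (tnullary 4) (Pair x y) x, [::]);
    (* 33 *) (teval G (tnullary 5) (Pair x y) y, [::]);
    (* 34 *) (teval G (tbinary 6 f g) x (Pair y z),
               [:: teval G f x y; teval G g x z]);
    (* 35 *) (teval G (tbinary 7 f g) x z, [:: teval G g x y; teval G f y z]);
    (* 36 *) (teval G (tbinary 8 f g) (Pair x Zero) z, [:: teval G f x z]);
    (* 37 *) (teval G (tbinary 8 f g) (Pair x (Suc y)) w,
               [:: teval G (tbinary 8 f g) (Pair x y) z;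
                   teval G g (Pair x (Pair y z)) w]);
    (* 38 *) (teval G (tunary 9 f) x y,
               [:: teval G f (Pair x y) Zero; tbelow G f x y]);
    (* 39 *) (teval G (tnullary 10) x y, [:: tanswer G x y]);
    (* 40 *) (tbelow G f x Zero, [::]);
    (* 41 *) (tbelow G f x (Suc y),
               [:: tbelow G f x y; teval G f (Pair x y) (Suc z)]);
    (* 42 *) (tanswer (Pair Zero a) b (Suc Zero), [:: tdbl b c; tbit a c]);
    (* 43 *) (tanswer (Pair Zero a) b Zero, [:: tdbl b c; tbit a (Suc c)]);
    (* 44 *) (tanswer (tjoin G f) y z, [:: tdbl x y; tanswer G x z]);
    (* 45 *) (tanswer (tjoin G f) (Suc y) z,
               [:: tdbl x y; tbit f (Pair (Pair x z) (num 1))]);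
    (* 46 *) (tanswer (tfunc f G) x y,
               [:: tstack f (Pair (tcons g z) w); tcode g; teval G g x y]);
    (* 47 *) (tanswer (tapp G f) x y,
               [:: tanswer G Zero z; tanswer (tfunc z (tjoin G f)) x y]);
    (* 48 *) (temb G (Pair (Pair x y) (num 1)), [:: tanswer G x y]);
    (* 49 *) (temb G (Pair x y), [:: tdbl z y; temb (tapp G y) x])].

(** * Soundness of the clauses *)

Lemma stack_of_cons v m : stack_of (2 ^ v * m.*2.+1) =
  oapp ((@GenTree.decode_step nat)^~ (stack_of m)) (stack_of m) (sum_of_nat v).
Proof. by rewrite /stack_of decode_cons /=; case: sum_of_nat. Qed.

Lemma enc_sum0 o : 0 = enc_sum o -> o = None.
Proof. by case: o => [[x|x]|] // /(congr1 cfst); rewrite !cK. Qed.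

Lemma enc_sum1 o x : cpair 1 x = enc_sum o -> o = Some (inr x).
Proof.
by case: o => [[y|y]|] /= E; have := congr1 cfst E; rewrite !cK //; case: (cpair_inj E) => _ ->.
Qed.

Lemma enc_sum2 o x : cpair 2 x = enc_sum o -> o = Some (inl x).
Proof.
by case: o => [[y|y]|] /= E; have := congr1 cfst E; rewrite !cK //; case: (cpair_inj E) => _ ->.
Qed.

Lemma program_sound n : derives program n -> meaning n.
Proof.
have bitS d k : D d k.+1 = D d./2 k by rewrite /D testbitS.
Ltac each_clause :=
  split; [let r := fresh "r" in move=> r; rewrite /meaning /= !cK /=;
          move: {r} (r 0) (r 1) (r 2) (r 3) (r 4) (r 5) (r 6)
         | try each_clause].
Ltac invert_code := let G := fresh "G" in let c := fresh "c" in
  let EG := fresh "EG" in move=> G c EG; rewrite /enc_code;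
  case: c => [|||||? ?|? ?|? ?|?|] /= /cpair_inj[] // _.
(* The bullets follow the numbering of the clauses; the last one is the [True] that ends the
   [foldr]. *)
apply: derives_sound; rewrite /program {n}; each_clause.
- by [].
- by move=> a b _ _ _ _ _ [->].
- by move=> a b _ _ _ _ _ [-> _]; rewrite /D testbit0 /= odd_double.
- by move=> a b c _ _ _ _ [-> [H _]]; rewrite bitS doubleK.
- by move=> a b c _ _ _ _ [-> [H _]]; rewrite bitS /= uphalf_double.
- by move=> a b _ _ _ _ _ [-> _]; rewrite mul1n.
- by move=> a b c d _ _ _ [-> [-> _]]; rewrite expnS -mulnA mul2n.
- by [].
- by move=> a b _ _ _ _ _ [-> _]; rewrite /sum_of_nat decode_cons.
- move=> a b c d m _ _ [-> [-> _]]; rewrite /sum_of_nat !decode_cons.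
  (* Only 0 codes the empty list, so [m.+1] contributes a third entry and the list is not a pair. *)
  by case E: (CodeSeq.decode m.+1) (CodeSeq.decodeK m.+1).
- by move=> a b c d m n _ [-> [-> [-> _]]]; rewrite /sum_of_nat !decode_cons.
- by move=> a b c _ m n _ [-> [-> [-> _]]]; rewrite /sum_of_nat !decode_cons.
- by move=> a _ c _ _ _ _ [-> [-> _]]; rewrite /sum_of_nat !decode_cons.
- by [].
- move=> a b c d _ _ _ [-> [/enc_sum0 Es [-> _]]].
  by rewrite stack_of_cons Es.
- move=> a b c d m n _ [-> [/enc_sum1 Es [Ec _]]]; rewrite stack_of_cons Es.
  by case: (stack_of c) Ec => f1 f2 /cpair_inj[-> ->].
- move=> a b c d m _ _ [-> [/enc_sum2 Es [Ec _]]]; rewrite stack_of_cons Es.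
  by case: (stack_of c) Ec => f1 f2 /cpair_inj[-> ->].
- move=> a b c d _ n _ [-> [/enc_sum2 Es [Ec _]]]; rewrite stack_of_cons Es.
  by case: (stack_of c) Ec => f1 [|? ?] /cpair_inj[-> //].
- move=> a b c d m n w [-> [/enc_sum2 Es [Ec _]]]; rewrite stack_of_cons Es.
  by case: (stack_of c) Ec => f1 [|h t] /cpair_inj[-> //= [/cpair_inj[-> ->]]].
- by exists CZero.
- by exists CSucc.
- by exists CId.
- by exists CFst.
- by exists CSnd.
- by move=> _ f g _ _ _ _ [[c1 <-] [[c2 <-] _]]; exists (CPair c1 c2).
- by move=> _ f g _ _ _ _ [[c1 <-] [[c2 <-] _]]; exists (CComp c1 c2).
- by move=> _ f g _ _ _ _ [[c1 <-] [[c2 <-] _]]; exists (CPrim c1 c2).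
- by move=> _ f _ _ _ _ _ [[c1 <-] _]; exists (CMu c1).
- by exists COracle.
- by move=> ? _ _ x _ _ _ _; invert_code; constructor.
- by move=> ? _ _ x _ _ _ _; invert_code; constructor.
- by move=> ? _ _ x _ _ _ _; invert_code; constructor.
- by move=> ? _ _ x y _ _ _; invert_code; constructor.
- by move=> ? _ _ x y _ _ _; invert_code; constructor.
- move=> ? f g x y z _ [Hf [Hg _]]; invert_code.
  move=> [/cpair_inj[E1 [/cpair_inj[E2 _]]]].
  by constructor; [apply: Hf | apply: Hg].
- move=> ? f g x y z _ [Hg [Hf _]]; invert_code.
  move=> [/cpair_inj[E1 [/cpair_inj[E2 _]]]].
  by apply: (@ev_comp _ _ _ _ y); [apply: Hg | apply: Hf].
- move=> ? f g x _ z _ [Hf _]; invert_code.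
  by move=> [/cpair_inj[E1 _]]; constructor; apply: Hf.
- move=> ? f g x y z w [Hr [Hg _]]; invert_code => E.
  apply: (@ev_primS _ _ _ _ _ z); first by apply: Hr; rewrite // -E.
  by case: E => /cpair_inj[_ [/cpair_inj[E2 _]]]; apply: Hg.
- move=> ? f _ x y _ _ [Hf [Hm _]]; invert_code.
  by move=> [/cpair_inj[E1 _]]; constructor; [apply: Hf | apply: Hm].
- by move=> ? _ _ x y _ _ [H _]; invert_code => _; constructor; apply: H.
- by [].
- move=> ? f _ x y z _ [Hb [Hf _]] G c EG Ec i.
  rewrite ltnS leq_eqVlt => /predU1P[->|]; last exact: Hb.
  by exists z.+1; split=> //; apply: Hf.
- by move=> v i k _ _ _ _ [-> [H _]] [?|? ?|? ?|? ?] /= /cpair_inj[] // _ ->; left.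
- by move=> v i k _ _ _ _ [-> [H _]] [?|? ?|? ?|? ?] /= /cpair_inj[] // _ ->; right.
- move=> g u _ k i j _ [-> [H _]] [?|? ?|? ?|? ?] /= /cpair_inj[] // _ /cpair_inj[E _].
  by left; exists k; split=> //; apply: H.
- move=> g u _ k i j _ [-> [H _]] [?|? ?|? ?|? ?] /= /cpair_inj[] // _ /cpair_inj[_ ->].
  by right; exists k.
- move=> g e c i j z w [Es [[c' Ec] [H _]]] [?|? ?|? ?|? ?] /= /cpair_inj[] // _ /cpair_inj[-> Eg].
  exists c'; split; last exact: H.
  rewrite unpickle_codeE; case: (stack_of e) Es => [[|t s] f2] /cpair_inj[] //= [].
  (* The top tree has the same number as the program [c'], hence is its tree. *)
  by move=> /cpair_inj[]; rewrite -Ec => /esym/enc_code_tree-> _ _; rewrite code_treeK.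
- move=> g u _ i j e _ [H0 [H _]] [?|? ?|? ?|? ?] /= /cpair_inj[] // _ /cpair_inj[Eg ->].
  by exists e; split; [apply: H0 | apply: (H (Func e (Join _ _))); rewrite /= Eg].
- by move=> g _ _ i j _ _ [H _] G EG; constructor; apply: H.
- move=> g _ _ x u a _ [-> [H _]] G EG; constructor.
  by apply: (H (App G _)); rewrite /= EG.
- by [].
Qed.

(** * Completeness of the clauses *)

Ltac use_clause i s := apply: (@derives_clause program i s);
  [by [] | rewrite /=; repeat (refine (conj _ _)); try exact: Logic.I].

Lemma derives_dbl a : derives program (jdbl a a.*2).
Proof.
elim: a => [|a IHa]; first by use_clause 0 (@nil nat).
(* The list gives the values of [V 0], [V 1] and so on; variables past its end are 0. *)
by use_clause 1 [:: a; a.*2].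
Qed.

Lemma derives_bit u k : D u k -> derives program (jbit u k).
Proof.
have Hd := derives_dbl u./2.
elim: k u Hd => [|k IHk] u Hd; rewrite /D ?testbit0 ?testbitS => Hu.
  have Eu: u = (u./2).*2.+1 by rewrite -{1}[u]odd_double_half Hu.
  by rewrite Eu; use_clause 2 [:: u./2; u./2.*2].
have {IHk}Hk := IHk u./2 (derives_dbl _) Hu.
rewrite -[u]odd_double_half; case: (odd u).
  by use_clause 4 [:: u./2; u./2.*2; k].
by use_clause 3 [:: u./2; u./2.*2; k].
Qed.

Lemma derives_pow v m : derives program (jpow v m (2 ^ v * m.*2.+1)).
Proof.
elim: v => [|v IHv].
  by rewrite mul1n; use_clause 5 [:: m; m.*2]; apply: derives_dbl.
set k := 2 ^ v * m.*2.+1; have ->: 2 ^ v.+1 * m.*2.+1 = k.*2.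
  by rewrite expnS -mulnA mul2n.
by use_clause 6 [:: k; k.*2; v; m]; first exact: derives_dbl.
Qed.

Lemma decodeP n : n = 0 \/ exists v m,
  CodeSeq.decode n = v :: CodeSeq.decode m /\ derives program (jpow v m n).
Proof.
rewrite -(CodeSeq.decodeK n); case: (CodeSeq.decode n) => [|v s]; first by left.
right; exists v, (CodeSeq.code s); split; last exact: derives_pow.
by rewrite !CodeSeq.codeK.
Qed.

(** The cases are lists of length 0, 1, at least 3, and 2, the last split by which entries decode to
    the empty list; a nonempty second entry wins, as in [sum_of_opair]. *)
Lemma derives_sum v : derives program (jsum v (enc_sum (sum_of_nat v))).
Proof.
case: (decodeP v) => [->|[a [m [Dv Hv]]]]; first by use_clause 7 (@nil nat).
rewrite /sum_of_nat Dv.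
case: (decodeP m) => [Em|[b [k [Dm Hm]]]].
  by subst m; use_clause 8 [:: v; a].
rewrite Dm; case: k {Dm} Hm => [|k] Hm; last first.
  case E: (CodeSeq.decode k.+1) (CodeSeq.decodeK k.+1) => // _.
  by use_clause 9 [:: v; a; m; b; k].
case: (decodeP b) => [Eb|[y [n [Db Hb]]]]; last first.
  by rewrite Db /=; use_clause 10 [:: v; a; m; b; y; n].
subst b; case: (decodeP a) => [Ea|[x [n [Da Ha]]]]; last first.
  by rewrite Da /=; use_clause 11 [:: v; a; m; 0; x; n].
by subst a; use_clause 12 [:: v; 0; m].
Qed.

Lemma derives_stack k : derives program (jstack k (enc_stack (stack_of k))).
Proof.
rewrite -(CodeSeq.decodeK k).
elim: (CodeSeq.decode k) => [|v s IHs]; first by use_clause 13 (@nil nat).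
set m := CodeSeq.code s in IHs *; rewrite -[CodeSeq.code _]/(2 ^ v * m.*2.+1).
have Hk := derives_pow v m; have := derives_sum v; rewrite stack_of_cons.
move: (2 ^ v * _) Hk => {}k Hk.
case: (sum_of_nat v) => [[[|n]|y]|] Hv.
- by use_clause 16 [:: k; v; m; enc_seq enc_tree (stack_of m).1;
    enc_seq (enc_seq enc_tree) (stack_of m).2].
- move: IHs; rewrite /enc_stack; case: (stack_of m) => f1 [|h t] /= IHs.
    by use_clause 17 [:: k; v; m; enc_seq enc_tree f1; 0; n].
  by use_clause 18 [:: k; v; m; enc_seq enc_tree f1; enc_seq enc_tree h; n;
    enc_seq (enc_seq enc_tree) t].
- by use_clause 15 [:: k; v; m; enc_seq enc_tree (stack_of m).1;
    enc_seq (enc_seq enc_tree) (stack_of m).2; y].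
- by use_clause 14 [:: k; v; m; enc_stack (stack_of m)].
Qed.

Lemma derives_code c : derives program (jcode (enc_code c)).
Proof.
elim: c => [|||||f IHf g IHg|f IHf g IHg|f IHf g IHg|f IHf|].
- by use_clause 19 (@nil nat).
- by use_clause 20 (@nil nat).
- by use_clause 21 (@nil nat).
- by use_clause 22 (@nil nat).
- by use_clause 23 (@nil nat).
- by use_clause 24 [:: 0; enc_code f; enc_code g].
- by use_clause 25 [:: 0; enc_code f; enc_code g].
- by use_clause 26 [:: 0; enc_code f; enc_code g].
- by use_clause 27 [:: 0; enc_code f].
- by use_clause 28 (@nil nat).
Qed.

(** Relating numbers directly to relations lets the relation vary in inductions on [emb]. *)
Definition answers (G : nat) (a : oracle) : Prop :=
  forall i j, a i j -> derives program (janswer G i j).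

Lemma derives_eval G a c x y : answers G a -> eval a c x y ->
  derives program (jeval G (enc_code c) x y).
Proof.
move=> HG; move: c x y; apply: eval_nested_ind.
- by move=> x; use_clause 29 [:: G; 0; 0; x].
- by move=> x; use_clause 30 [:: G; 0; 0; x].
- by move=> x; use_clause 31 [:: G; 0; 0; x].
- by move=> x y; use_clause 32 [:: G; 0; 0; x; y].
- by move=> x y; use_clause 33 [:: G; 0; 0; x; y].
- by move=> f g x y z Hf Hg; use_clause 34 [:: G; enc_code f; enc_code g; x; y; z].
- by move=> f g x y z Hg Hf; use_clause 35 [:: G; enc_code f; enc_code g; x; y; z].
- by move=> f g x z Hf; use_clause 36 [:: G; enc_code f; enc_code g; x; 0; z].
- by move=> f g x y z w Hr Hg; use_clause 37 [:: G; enc_code f; enc_code g; x; y; z; w].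
- move=> f x y Hf Hb; use_clause 38 [:: G; enc_code f; 0; x; y] => //.
  rewrite -/(jbelow G (enc_code f) x y).
  elim: y Hb {Hf} => [|y IHy] Hb; first by use_clause 40 [:: G; enc_code f; 0; x].
  have [[|k] [// _ Hk]] := Hb y (ltnSn y).
  use_clause 41 [:: G; enc_code f; 0; x; y; k] => //.
  by apply: IHy => z ltz; apply/Hb/ltnW.
- by move=> x y /HG H; use_clause 39 [:: G; 0; 0; x; y].
Qed.

Lemma answers_base v : answers (cpair 0 v) (base_rel v).
Proof.
move=> i j [[-> /derives_bit Hb]|[-> /derives_bit Hb]].
  by use_clause 42 [:: v; i; i.*2]; first exact: derives_dbl.
by use_clause 43 [:: v; i; i.*2]; first exact: derives_dbl.
Qed.

Lemma answers_join G a u : answers G a ->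
  answers (cpair 1 (cpair G u)) (join_rel a (decode_rel u)).
Proof.
move=> HG i j [] [k [->]] => [/HG|/derives_bit] H.
  by use_clause 44 [:: G; u; 0; k; k.*2; j]; first exact: derives_dbl.
by use_clause 45 [:: G; u; 0; k; k.*2; j]; first exact: derives_dbl.
Qed.

Lemma answers_func G a e : answers G a -> answers (cpair 2 (cpair e G)) (Phi e a).
Proof.
move=> HG i j [c [Ue Ec]].
have := derives_stack e; move: Ue; rewrite unpickle_codeE.
case: (stack_of e) => [[|t s] f] //= Et Hs.
use_clause 46 [:: G; e; enc_code c; i; j; enc_seq enc_tree s;
  enc_seq (enc_seq enc_tree) f].
- by rewrite /enc_code (tree_to_codeK Et).
- exact: derives_code.
- exact: derives_eval Ec.
Qed.

Lemma answers_app G a u : answers G a ->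
  answers (cpair 3 (cpair G u)) (app_rel a (decode_rel u)).
Proof.
move=> HG i j [e [/HG He Ee]].
have H := answers_func (answers_join (u := u) HG) Ee.
by use_clause 47 [:: G; u; 0; i; j; e].
Qed.

Lemma derives_emb G a x : answers G a -> emb a x -> derives program (jemb G x).
Proof.
move=> HG H; elim: H G HG => {a x} [a i j aij G HG|a x u _ IH G HG].
  have H := HG _ _ aij.
  by use_clause 48 [:: G; 0; 0; i; j].
have H := IH _ (answers_app HG).
by use_clause 49 [:: G; 0; 0; x; u.*2; u]; first exact: derives_dbl.
Qed.

Lemma derives_embE e v x :
  derives program (jemb (cpair 2 (cpair e (cpair 0 v))) x) <->
  emb (Phi e (base_rel v)) x.
Proof.
split=> [/program_sound|]; last exact/derives_emb/answers_func/answers_base.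
by rewrite /meaning /jemb !cK => /(_ (Func e (Base v)) erefl).
Qed.

(** * Images of partial functions computable in X *)

Lemma base_rel_incl v X :
  (forall k, D v k -> join_compl X k) -> incl (base_rel v) (chi X).
Proof.
move=> Hv i j [[-> /Hv]|[-> /Hv]] [] [k [Ek Xk]].
- by left; rewrite -(doubleK i) Ek doubleK in Xk *.
- by have := congr1 odd Ek; rewrite /= !odd_double.
- by have := congr1 odd Ek; rewrite /= !odd_double.
- by right; case: Ek => /(congr1 half); rewrite !doubleK => ->.
Qed.

Lemma chi_finite X s : incl (rel_of s) (chi X) ->
  exists v, (forall k, D v k -> join_compl X k) /\ incl (rel_of s) (base_rel v).
Proof.
(* [g] sends a pair in the graph of [chi X] to the element of [join_compl X] that certifies it. *)
move=> Hs; pose g k := if csnd k == 1 then (cfst k).*2 else (cfst k).*2.+1.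
have [v Hv] := finite_code [seq g k | k <- s]; exists v; split=> [k /Hv/mapP[l sl ->]|i j sij].
  have: chi X (cfst l) (csnd l) by apply: Hs; rewrite /rel_of cfst_csndK.
  rewrite /g; case=> -[Xl ->] /=; [left | right]; by exists (cfst l).
have Hg: D v (g (cpair i j)) by apply/Hv/map_f.
by move: Hg; rewrite /g !cK; case: (Hs _ _ sij) => -[_ ->]; [left | right].
Qed.

Lemma emb_Phi_inGY X e : inGY (join_compl X) (emb (Phi e (chi X))).
Proof.
(* This maps [cpair x v] to the judgement that [x] lies in [emb (Phi e (base_rel v))]. *)
pose t n := jemb (cpair 2 (cpair e (cpair 0 (csnd n)))) (cfst n).
pose A n := derives program (t n).
have ->: emb (Phi e (chi X)) = Gapp A (join_compl X).
  apply: functional_extensionality => x; apply: propositional_extensionality.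
  have C := continuous_comp (continuous_emb x) (continuous_Phi e).
  split=> [/(proj2 C)[s [/chi_finite[v [Xv sv]] Hs]]|[v [Hx Xv]]].
    exists v; split=> //; rewrite /A /t !cK; apply/derives_embE.
    exact: (proj1 C) Hs.
  move: Hx; rewrite /A /t !cK => /derives_embE.
  exact/(proj1 C)/base_rel_incl.
apply/GY_app/GY_base; apply/GY_ce/ce_derives.
apply/comp_pair/comp_pair/comp_fst/comp_id; first exact: comp_const.
apply/comp_pair/comp_pair/comp_pair/comp_snd/comp_id; exact: comp_const.
Qed.

Lemma emb_ext R R' : (forall i j, R i j <-> R' i j) -> emb R = emb R'.
Proof.
move=> E; apply: functional_extensionality => x.
by apply: propositional_extensionality; split; apply: emb_mono => i j /E.
Qed.

Theorem theorem7p3 :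
  exists F : pfun -> (nat -> Prop),
    (* F is an embedding of pcas B -> G *)
    (forall f g, F f = F g -> f = g) /\
    (forall f g h, Bapp f g h -> Gapp (F f) (F g) = F h) /\
    (* which restricts to B^X -> G^(X (+) complement X) for every X *)
    (forall (X : nat -> Prop) (f : pfun), inBX X f -> inGY (join_compl X) (F f)).
Proof.
exists (fun f => emb (graph f)); split=> [f g Efg|].
  apply: functional_extensionality => i.
  have E j : f i = Some j <-> g i = Some j.
    by rewrite -[_ <-> _]/(graph f i j <-> graph g i j) -!emb_graphE Efg.
  case Ef: (f i) => [j|]; first by apply/esym/E.
  by case Eg: (g i) => [j|] //; move/E: Eg; rewrite Ef.
split=> [f g h Hh|X f [e He]].
  (* By conversion [pjoin f g] is [join_rel] of the graphs, so [Hh] identifies the graph of [h] with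
     [app_rel] of the graphs. *)
  by rewrite emb_app_rel; apply: emb_ext => i j; rewrite /graph Hh.
by rewrite (emb_ext (R' := Phi e (chi X))) //; apply: emb_Phi_inGY.
Qed.
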